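(* Let $a\in\mathbb R$, $\lambda,\varepsilon,\Delta x,\Delta t>0$, $\sigma=\Delta t/\Delta x$. Let $(\mathbf U_j^n)_{j\in\mathbb Z,n\in\mathbb N}$, $\mathbf U_j^n=(u_j^n,v_j^n)^\top$, be generated by the Lie splitting scheme given in the context. Let $\bar{\mathbf U}_j^n=(\bar u_j^n,a\bar u_j^n)^\top$ for all $j\in\mathbb Z$, $n\in\mathbb N$, and assume that it satisfies the discrete entropy identity at equilibrium $$\bar\eta_j^{n+1}+\sigma\bigl(\bar\Psi_{j+\frac12}^n-\bar\Psi_{j-\frac12}^n\bigr)=\bar\eta_j^n-\sigma\bar R_j^{1,n}-\sigma\bar R_j^{2,n}+\frac{\sigma^2}{2}\bar R_j^{3,n}\qquad(j\in\mathbb Z,\ n\in\mathbb N).$$ Then, for all $j\in\mathbb Z$ and $n\in\mathbb N$, $$\begin{aligned}\eta_{j,\mathrm{rel}}^{n+1}&+\sigma\bigl(\Psi_{j+\frac12,\mathrm{rel}}^n-\Psi_{j-\frac12,\mathrm{rel}}^n\bigr)+\sigma\bigl(\Gamma_{j+\frac12}^n-\Gamma_{j-\frac12}^n\bigr)\\&=\eta_{j,\mathrm{rel}}^n-\sigma(R_j^{1,n}-\bar R_j^{1,n})-\sigma(R_j^{2,n}-\bar R_j^{2,n})+\frac{\sigma^2}{2}(R_j^{3,n}-\bar R_j^{3,n})-R_j^{4,n}\\&\quad-\frac{\Delta t}{\varepsilon}(\Delta v_j^{n+1}-a\Delta u_j^{n+1})^2-\frac{\Delta t^2}{2\varepsilon^2}(\Delta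 v_j^{n+1}-a\Delta u_j^{n+1})^2,\end{aligned}$$ where $$R_j^{4,n}=\nabla\eta(\bar{\mathbf U}_j^{n+1})\cdot\Delta\mathbf U_j^{n+1}-\nabla\eta(\bar{\mathbf U}_j^n)\cdot\Delta\mathbf U_j^n,$$ $$\Gamma_{j+\frac12}^n=\frac12\Bigl(\nabla\eta(\bar{\mathbf U}_j^n)\cdot A\,\Delta\mathbf U_{j+1}^n+\nabla\eta(\bar{\mathbf U}_{j+1}^n)\cdot A\,\Delta\mathbf U_j^n\Bigr).$$
   Context: Notation: $A=\begin{pmatrix}0&1\\\lambda^2&0\end{pmatrix}$, $H=\begin{pmatrix}\lambda^2&-a\\-a&1\end{pmatrix}$, $\mathbf F(\mathbf U)=A\mathbf U$, $\mathbf R(\mathbf U)=(0,\,au-v)^\top$ for $\mathbf U=(u,v)^\top$, $\eta(\mathbf U)=\frac12\mathbf U^\top H\mathbf U$, $\nabla\eta(\mathbf U)=H\mathbf U$. Lie splitting scheme: for $j\in\mathbb Z$, $n\in\mathbb N$, $$\mathbf U_j^{n+\frac12}=\mathbf U_j^n-\sigma(\widehat{\mathbf F}_{j+\frac12}^n-\widehat{\mathbf F}_{j-\frac12}^n),\quad \widehat{\mathbf F}_{j+\frac12}^n=\tfrac12\bigl(\mathbf F(\mathbf U_j^n)+\mathbf F(\mathbf U_{j+1}^n)\bigr)-\tfrac\lambda2(\mathbf U_{j+1}^n-\mathbf U_j^n),$$ $$\mathbf U_j^{n+1}=\mathbf U_j^{n+\frac12}+\frac{\Delta t}{\varepsilon}\mathbf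 R(\mathbf U_j^{n+1}).$$ Terms for the relaxation solution, with $\|\mathbf X\|_H^2=\mathbf X^\top H\mathbf X$: $$R_j^{1,n}=\tfrac\lambda4\bigl[\|\mathbf U_{j+1}^n-\mathbf U_j^n\|_H^2+\|\mathbf U_j^n-\mathbf U_{j-1}^n\|_H^2\bigr],\quad R_j^{2,n}=-\tfrac\lambda4\bigl[\|\mathbf U_{j+1}^n\|_H^2-2\|\mathbf U_j^n\|_H^2+\|\mathbf U_{j-1}^n\|_H^2\bigr],$$ $$R_j^{3,n}=\|\widehat{\mathbf F}_{j+\frac12}^n-\widehat{\mathbf F}_{j-\frac12}^n\|_H^2.$$ Terms for the equilibrium sequence, with $\widehat f_{j+\frac12}^n=\frac a2(\bar u_j^n+\bar u_{j+1}^n)-\frac\lambda2(\bar u_{j+1}^n-\bar u_j^n)$: $$\bar\eta_j^n=\tfrac{\lambda^2-a^2}{2}(\bar u_j^n)^2,\qquad \bar\Psi_{j+\frac12}^n=\tfrac{a(\lambda^2-a^2)}{2}\bar u_j^n\bar u_{j+1}^n,$$ $$\bar R_j^{1,n}=\tfrac{\lambda(\lambda^2-a^2)}{4}\bigl[(\bar u_{j+1}^n-\bar u_j^n)^2+(\bar u_j^n-\bar u_{j-1}^n)^2\bigr],$$ $$\bar R_j^{2,n}=-\tfrac{\lambda(\lambda^2-a^2)}{4}\bigl[(\bar u_{j+1}^n)^2-2(\bar u_j^n)^2+(\bar u_{j-1}^n)^2\bigr],\qquad \bar R_j^{3,n}=(\lambda^2-a^2)\bigl(\widehat f_{j+\frac12}^n-\widehat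 f_{j-\frac12}^n\bigr)^2.$$ Relative quantities: $\Delta\mathbf U_j^n=\mathbf U_j^n-\bar{\mathbf U}_j^n=(\Delta u_j^n,\Delta v_j^n)^\top$, $$\eta_{j,\mathrm{rel}}^n=\eta(\mathbf U_j^n)-\eta(\bar{\mathbf U}_j^n)-\nabla\eta(\bar{\mathbf U}_j^n)\cdot\Delta\mathbf U_j^n,\qquad \Psi_{j+\frac12,\mathrm{rel}}^n=\tfrac12(\Delta\mathbf U_j^n)^\top HA\,\Delta\mathbf U_{j+1}^n.$$ *)

(* Defs.v *)
From HB Require Import structures.
From mathcomp Require Import all_boot all_order all_algebra.
From mathcomp Require Import reals.

Set Implicit Arguments.
Unset Strict Implicit.
Unset Printing Implicit Defensive.

Import Order.TTheory GRing.Theory Num.Theory.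
Local Open Scope ring_scope.

(* Grid functions have type [nat -> int -> _]: time index n,
   then space index j.  A quantity attached to the interface j + 1/2 is indexed
   by j, so its value at j - 1/2 is the one at index [j - 1]. *)

Definition vec2 (R : realType) (x y : R) : 'cV[R]_2 :=
  \col_i (if i == 0 then x else y).

Definition mat2 (R : realType) (p q r s : R) : 'M[R]_2 :=
  \matrix_(i, j) (if i == 0 then (if j == 0 then p else q)
                  else (if j == 0 then r else s)).

Definition ucomp (R : realType) (X : 'cV[R]_2) : R := X 0 0.
Definition vcomp (R : realType) (X : 'cV[R]_2) : R := X 1 0.

Definition dotv (R : realType) (X Y : 'cV[R]_2) : R := (X^T *m Y) 0 0.

Definition matA (R : realType) (lambda : R) : 'M[R]_2 :=
  mat2 0 1 (lambda ^+ 2) 0.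

Definition matH (R : realType) (a lambda : R) : 'M[R]_2 :=
  mat2 (lambda ^+ 2) (- a) (- a) 1.

Definition flux (R : realType) (lambda : R) (X : 'cV[R]_2) : 'cV[R]_2 :=
  matA lambda *m X.

Definition relax (R : realType) (a : R) (X : 'cV[R]_2) : 'cV[R]_2 :=
  vec2 0 (a * ucomp X - vcomp X).

Definition normH2 (R : realType) (a lambda : R) (X : 'cV[R]_2) : R :=
  (X^T *m matH a lambda *m X) 0 0.

Definition eta (R : realType) (a lambda : R) (X : 'cV[R]_2) : R :=
  2^-1 * (X^T *m matH a lambda *m X) 0 0.

Definition grad_eta (R : realType) (a lambda : R) (X : 'cV[R]_2) : 'cV[R]_2 :=
  matH a lambda *m X.

Definition Fhat (R : realType) (lambda : R) (U : nat -> int -> 'cV[R]_2)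
    (n : nat) (j : int) : 'cV[R]_2 :=
  2^-1 *: (flux lambda (U n j) + flux lambda (U n (j + 1)))
  - (lambda / 2) *: (U n (j + 1) - U n j).

(* The intermediate state U_j^{n + 1/2}. *)
Definition transport_step (R : realType) (lambda sigma : R)
    (U : nat -> int -> 'cV[R]_2) (n : nat) (j : int) : 'cV[R]_2 :=
  U n j - sigma *: (Fhat lambda U n j - Fhat lambda U n (j - 1)).

Definition Lie_splitting (R : realType) (a lambda eps sigma dt : R)
    (U : nat -> int -> 'cV[R]_2) : Prop :=
  forall (n : nat) (j : int),
    U n.+1 j =
      transport_step lambda sigma U n j + (dt / eps) *: relax a (U n.+1 j).

Definition R1 (R : realType) (a lambda : R) (U : nat -> int -> 'cV[R]_2)
    (n : nat) (j : int) : R :=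
  lambda / 4 * (normH2 a lambda (U n (j + 1) - U n j)
                + normH2 a lambda (U n j - U n (j - 1))).

Definition R2 (R : realType) (a lambda : R) (U : nat -> int -> 'cV[R]_2)
    (n : nat) (j : int) : R :=
  - (lambda / 4) * (normH2 a lambda (U n (j + 1))
                    - 2 * normH2 a lambda (U n j)
                    + normH2 a lambda (U n (j - 1))).

Definition R3 (R : realType) (a lambda : R) (U : nat -> int -> 'cV[R]_2)
    (n : nat) (j : int) : R :=
  normH2 a lambda (Fhat lambda U n j - Fhat lambda U n (j - 1)).

Definition equilibrium (R : realType) (a : R) (ub : nat -> int -> R)
    (n : nat) (j : int) : 'cV[R]_2 :=
  vec2 (ub n j) (a * ub n j).

Definition fhat (R : realType) (a lambda : R) (ub : nat -> int -> R)
    (n : nat) (j : int) : R :=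
  a / 2 * (ub n j + ub n (j + 1)) - lambda / 2 * (ub n (j + 1) - ub n j).

Definition eta_bar (R : realType) (a lambda : R) (ub : nat -> int -> R)
    (n : nat) (j : int) : R :=
  (lambda ^+ 2 - a ^+ 2) / 2 * ub n j ^+ 2.

Definition Psi_bar (R : realType) (a lambda : R) (ub : nat -> int -> R)
    (n : nat) (j : int) : R :=
  a * (lambda ^+ 2 - a ^+ 2) / 2 * ub n j * ub n (j + 1).

Definition R1_bar (R : realType) (a lambda : R) (ub : nat -> int -> R)
    (n : nat) (j : int) : R :=
  lambda * (lambda ^+ 2 - a ^+ 2) / 4
  * ((ub n (j + 1) - ub n j) ^+ 2 + (ub n j - ub n (j - 1)) ^+ 2).

Definition R2_bar (R : realType) (a lambda : R) (ub : nat -> int -> R)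
    (n : nat) (j : int) : R :=
  - (lambda * (lambda ^+ 2 - a ^+ 2) / 4)
  * (ub n (j + 1) ^+ 2 - 2 * ub n j ^+ 2 + ub n (j - 1) ^+ 2).

Definition R3_bar (R : realType) (a lambda : R) (ub : nat -> int -> R)
    (n : nat) (j : int) : R :=
  (lambda ^+ 2 - a ^+ 2)
  * (fhat a lambda ub n j - fhat a lambda ub n (j - 1)) ^+ 2.

Definition equilibrium_entropy_identity (R : realType) (a lambda sigma : R)
    (ub : nat -> int -> R) : Prop :=
  forall (n : nat) (j : int),
    eta_bar a lambda ub n.+1 j
    + sigma * (Psi_bar a lambda ub n j - Psi_bar a lambda ub n (j - 1))
    = eta_bar a lambda ub n j
      - sigma * R1_bar a lambda ub n j
      - sigma * R2_bar a lambda ub n j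
      + sigma ^+ 2 / 2 * R3_bar a lambda ub n j.

Definition Delta (R : realType) (U Ub : nat -> int -> 'cV[R]_2)
    (n : nat) (j : int) : 'cV[R]_2 :=
  U n j - Ub n j.

Definition eta_rel (R : realType) (a lambda : R)
    (U Ub : nat -> int -> 'cV[R]_2) (n : nat) (j : int) : R :=
  eta a lambda (U n j) - eta a lambda (Ub n j)
  - dotv (grad_eta a lambda (Ub n j)) (Delta U Ub n j).

Definition Psi_rel (R : realType) (a lambda : R)
    (U Ub : nat -> int -> 'cV[R]_2) (n : nat) (j : int) : R :=
  2^-1 * ((Delta U Ub n j)^T *m (matH a lambda *m matA lambda)
          *m Delta U Ub n (j + 1)) 0 0.

Definition R4 (R : realType) (a lambda : R)
    (U Ub : nat -> int -> 'cV[R]_2) (n : nat) (j : int) : R :=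
  dotv (grad_eta a lambda (Ub n.+1 j)) (Delta U Ub n.+1 j)
  - dotv (grad_eta a lambda (Ub n j)) (Delta U Ub n j).

Definition Gamma (R : realType) (a lambda : R)
    (U Ub : nat -> int -> 'cV[R]_2) (n : nat) (j : int) : R :=
  2^-1 * (dotv (grad_eta a lambda (Ub n j))
            (matA lambda *m Delta U Ub n (j + 1))
          + dotv (grad_eta a lambda (Ub n (j + 1)))
              (matA lambda *m Delta U Ub n j)).

(* Main.v *)
Require Import Defs.
From HB Require Import structures.
From mathcomp Require Import all_boot all_order all_algebra.
From mathcomp Require Import reals.
From mathcomp Require Import ring.

Set Implicit Arguments.
Unset Strict Implicit.
Unset Printing Implicit Defensive.

Import Order.TTheory GRing.Theory Num.Theory.
Local Open Scope ring_scope.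

(** The theorem is the difference of two discrete entropy balances, one for
    the relaxation solution and the assumed one for the equilibrium sequence.

    The balance for the relaxation solution comes from the two stages of the
    splitting.  Since [H A] is symmetric, expanding the quadratic form [eta] at
    [U - sigma (F+ - F-)] gives the conservative difference of the numerical
    entropy flux [1/2 U_j . H A U_(j+1)] together with [R1], [R2] and [R3]
    ([eta_transport_step]).  The implicit stage is
    [U^(n+1/2) = U^(n+1) - k R(U^(n+1))] with [k = dt / eps], and
    [U . H R(U) = - (v - a u)^2] while [R(U) . H R(U) = (v - a u)^2], so that
    it dissipates [(k + k^2 / 2) (v - a u)^2] exactly ([eta_relax_step]).

    Both [eta] and the numerical flux are then expanded around the equilibrium
    state.  The entropy of an equilibrium state is [eta_bar] ([eta_equilibrium]);
    the numerical flux splits into its equilibrium value [Psi_bar], the bilinear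
    remainder [Psi_rel], and the terms linear in the perturbation, which
    symmetry of [H A] identifies with [Gamma] ([Psi_expansion]).  Finally
    [v - a u] vanishes at equilibrium, so the dissipation
    depends on the perturbation alone ([relax_defect_Delta]). *)

Lemma vec2_col0 (R : realType) (x y : R) : vec2 x y 0 0 = x.
Proof. by rewrite mxE. Qed.

Lemma vec2_col1 (R : realType) (x y : R) : vec2 x y 1 0 = y.
Proof. by rewrite mxE. Qed.

Lemma lift_ord0_1 : lift ord0 ord0 = 1 :> 'I_2.
Proof. exact: val_inj. Qed.

Lemma dotvE (R : realType) (X Y : 'cV[R]_2) :
  dotv X Y = X 0 0 * Y 0 0 + X 1 0 * Y 1 0.
Proof. by rewrite /dotv mxE big_ord_recl big_ord1 lift_ord0_1 !mxE. Qed.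

Lemma mul_mat2_col0 (R : realType) (p q r s : R) (X : 'cV[R]_2) :
  (mat2 p q r s *m X) 0 0 = p * X 0 0 + q * X 1 0.
Proof. by rewrite mxE big_ord_recl big_ord1 lift_ord0_1 !mxE. Qed.

Lemma mul_mat2_col1 (R : realType) (p q r s : R) (X : 'cV[R]_2) :
  (mat2 p q r s *m X) 1 0 = r * X 0 0 + s * X 1 0.
Proof. by rewrite mxE big_ord_recl big_ord1 lift_ord0_1 !mxE. Qed.

Lemma bilin_dotv (R : realType) (M : 'M[R]_2) (X Y : 'cV[R]_2) :
  (X^T *m M *m Y) 0 0 = dotv X (M *m Y).
Proof. by rewrite /dotv mulmxA. Qed.

Lemma col_addE (R : realType) (X Y : 'cV[R]_2) i : (X + Y) i 0 = X i 0 + Y i 0.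
Proof. by rewrite mxE. Qed.

Lemma col_oppE (R : realType) (X : 'cV[R]_2) i : (- X) i 0 = - X i 0.
Proof. by rewrite mxE. Qed.

Lemma col_scaleE (R : realType) (c : R) (X : 'cV[R]_2) i :
  (c *: X) i 0 = c * X i 0.
Proof. by rewrite mxE. Qed.

(** Rewriting rules that reduce every expression in [H], [A] and column
    vectors to a polynomial in the components. *)
Definition coordE (R : realType) :=
  (@bilin_dotv R, @dotvE R, @mul_mat2_col0 R, @mul_mat2_col1 R,
   @vec2_col0 R, @vec2_col1 R, @col_addE R, @col_oppE R, @col_scaleE R).

(** The numerical entropy flux [1/2 U_j . H A U_(j+1)] at [j + 1/2]; at a
    constant state [U] it is the exact entropy flux [1/2 U . H A U]. *)
Definition Psi (R : realType) (a lambda : R) (U : nat -> int -> 'cV[R]_2)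
    (n : nat) (j : int) : R :=
  2^-1 * dotv (U n j) (matH a lambda *m (matA lambda *m U n (j + 1))).

(* The qualified name below separates the entropy from the constant [eta] of
   Hierarchy Builder. *)

Lemma eta_transport_step (R : realType) (a lambda sigma : R)
    (U : nat -> int -> 'cV[R]_2) (n : nat) (j : int) :
  Defs.eta a lambda (transport_step lambda sigma U n j)
  = Defs.eta a lambda (U n j)
    - sigma * (Psi a lambda U n j - Psi a lambda U n (j - 1))
    - sigma * R1 a lambda U n j - sigma * R2 a lambda U n j
    + sigma ^+ 2 / 2 * R3 a lambda U n j.
Proof.
rewrite /Psi /R1 /R2 /R3 /normH2 /Defs.eta /transport_step /Fhat /flux subrK.
rewrite /matA /matH !coordE.
by field.
Qed.

(** The implicit relaxation stage, with [X] the state before and [Y] the state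
    after it. *)
Lemma eta_relax_step (R : realType) (a lambda k : R) (X Y : 'cV[R]_2) :
  Y = X + k *: relax a Y ->
  Defs.eta a lambda Y
  = Defs.eta a lambda X - (k + k ^+ 2 / 2) * (vcomp Y - a * ucomp Y) ^+ 2.
Proof.
(* The stage is explicit when read backwards, as [X] in terms of [Y]. *)
move/(canLR (addrK _))=> <-.
rewrite /Defs.eta /relax /ucomp /vcomp /matH !coordE.
by field.
Qed.

Lemma eta_equilibrium (R : realType) (a lambda : R) (ub : nat -> int -> R)
    (n : nat) (j : int) :
  Defs.eta a lambda (equilibrium a ub n j) = eta_bar a lambda ub n j.
Proof.
rewrite /Defs.eta /eta_bar /equilibrium /matH !coordE.
by field.
Qed.

Lemma Psi_expansion (R : realType) (a lambda : R) (U : nat -> int -> 'cV[R]_2)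
    (ub : nat -> int -> R) (n : nat) (j : int) :
  Psi a lambda U n j
  = Psi_bar a lambda ub n j + Gamma a lambda U (equilibrium a ub) n j
    + Psi_rel a lambda U (equilibrium a ub) n j.
Proof.
rewrite /Psi /Psi_bar /Gamma /Psi_rel /Delta /grad_eta /equilibrium.
rewrite !bilin_dotv -!mulmxA /matA /matH !coordE.
by field.
Qed.

Lemma relax_defect_Delta (R : realType) (a : R) (U : nat -> int -> 'cV[R]_2)
    (ub : nat -> int -> R) (n : nat) (j : int) :
  vcomp (Delta U (equilibrium a ub) n j)
  - a * ucomp (Delta U (equilibrium a ub) n j)
  = vcomp (U n j) - a * ucomp (U n j).
Proof. by rewrite /vcomp /ucomp /Delta /equilibrium !coordE; ring. Qed.

Theorem lemma1 (R : realType) (a lambda eps dx dt sigma : R)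
  (hlambda : 0 < lambda) (heps : 0 < eps) (hdx : 0 < dx) (hdt : 0 < dt)
  (hsigma : sigma = dt / dx)
  (U : nat -> int -> 'cV[R]_2)
  (hU : Lie_splitting a lambda eps sigma dt U)
  (ub : nat -> int -> R) (Ub : nat -> int -> 'cV[R]_2)
  (hUb : forall (n : nat) (j : int), Ub n j = equilibrium a ub n j)
  (hub : equilibrium_entropy_identity a lambda sigma ub)
  (n : nat) (j : int) :
  eta_rel a lambda U Ub n.+1 j
  + sigma * (Psi_rel a lambda U Ub n j - Psi_rel a lambda U Ub n (j - 1))
  + sigma * (Gamma a lambda U Ub n j - Gamma a lambda U Ub n (j - 1))
  = eta_rel a lambda U Ub n j
    - sigma * (R1 a lambda U n j - R1_bar a lambda ub n j)
    - sigma * (R2 a lambda U n j - R2_bar a lambda ub n j)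
    + sigma ^+ 2 / 2 * (R3 a lambda U n j - R3_bar a lambda ub n j)
    - R4 a lambda U Ub n j
    - dt / eps * (vcomp (Delta U Ub n.+1 j)
                  - a * ucomp (Delta U Ub n.+1 j)) ^+ 2
    - dt ^+ 2 / (2 * eps ^+ 2) * (vcomp (Delta U Ub n.+1 j)
                                  - a * ucomp (Delta U Ub n.+1 j)) ^+ 2.
Proof.
have eps_neq0 : eps != 0 by rewrite gt_eqF.
have DeltaE m i : Delta U Ub m i = Delta U (equilibrium a ub) m i.
  by rewrite /Delta hUb.
have Psi_relE i :
    Psi_rel a lambda U Ub n i = Psi_rel a lambda U (equilibrium a ub) n i.
  by rewrite /Psi_rel !DeltaE.
have GammaE i :
    Gamma a lambda U Ub n i = Gamma a lambda U (equilibrium a ub) n i.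
  by rewrite /Gamma !DeltaE !hUb.
have := eta_relax_step lambda (hU n j).
rewrite eta_transport_step (Psi_expansion a lambda U ub n j).
rewrite (Psi_expansion a lambda U ub n (j - 1)) => balance.
(* Both balances give the entropy at time [n + 1], so the two entropies at that
   time are eliminated by rewriting. *)
have /(canRL (addrK _)) balance_bar := hub n j.
rewrite !Psi_relE !GammaE /eta_rel /R4 !DeltaE relax_defect_Delta !hUb.
rewrite !eta_equilibrium balance balance_bar.
by field.
Qed.
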